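(* Consider a system $(\Sigma)$ as in the context (in particular satisfying the Lipschitz condition (Lip) and the generalized monotonicity condition (Mon)) with $n\le l+p$, let $k\in\mathbb{N}_0$, and use the matrices and subspaces defined in the context. Let $\delta>0$, $\mathcal{P}\in\mathbb{R}^{(l+p)\times(n+k)}$ and $\mathcal{K}\in\mathbb{R}^{(n+k)\times(n+k)}$. (i) Let $L_1\in\mathbb{R}^{l\times k}$, $L_2\in\mathbb{R}^{p\times k}$ be such that $\mathcal{P}^\top\begin{bmatrix}0&L_1\\0&L_2\end{bmatrix}=\mathcal{K}H$, and suppose that, with $\mathcal{A}$ formed from these $L_1,L_2$, $$\mathcal{Q}:=\begin{bmatrix}\hat A^\top\mathcal{P}+\mathcal{P}^\top\hat A+H^\top\mathcal{K}^\top+\mathcal{K}H+\delta\mathcal{F}^\top\mathcal{F}-\mu\mathcal{J} & \mathcal{P}^\top\mathcal{B}+\hat\Theta\\ \mathcal{B}^\top\mathcal{P}+\hat\Theta^\top & -\delta\Lambda_{q_L}\end{bmatrix}<_{\mathcal{V}^*_{[[\mathcal{E},0],[\mathcal{A},\mathcal{B}]]}}0$$ and $$\mathcal{P}^\top\mathcal{E}=\mathcal{E}^\top\mathcal{P}>_{\overline{\mathcal{V}}^*_{[[\mathcal{E},0],[\mathcal{A},\mathcal{B}]]}}0 .$$ Then the system $(\Omega)$ with these $L_1,L_2$ is a state estimator for $(\Sigma)$. (ii) There exists at least one pair $L_1\in\mathbb{R}^{l\times k}$, $L_2\in\mathbb{R}^{p\times k}$ with $\mathcal{P}^\top\begin{bmatrix}0&L_1\\0&L_2\end{bmatrix}=\mathcal{K}H$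 if, and only if, $\operatorname{im}\mathcal{K}H\subseteq\operatorname{im}\mathcal{P}^\top$.
   Context: **System.** The system $(\Sigma)$ is $$\tfrac{d}{dt}Ex(t)=Ax(t)+B_Lf_L(x(t),u(t),y(t))+B_Mf_M(Jx(t),u(t),y(t)),\qquad y(t)=Cx(t)+h(u(t)),$$ where $E,A\in\mathbb{R}^{l\times n}$, $r=\operatorname{rk}E$, $B_L\in\mathbb{R}^{l\times q_L}$, $B_M\in\mathbb{R}^{l\times q_M}$, $J\in\mathbb{R}^{q_M\times n}$ with $\operatorname{rk}J=q_M$, $C\in\mathbb{R}^{p\times n}$; $\mathcal{X}\subseteq\mathbb{R}^n$, $\mathcal{U}\subseteq\mathbb{R}^m$, $\mathcal{Y}\subseteq\mathbb{R}^p$ are open, $\hat{\mathcal{X}}:=J\mathcal{X}\subseteq\mathbb{R}^{q_M}$; $h:\mathcal{U}\to\mathbb{R}^p$, $f_L:\mathcal{X}\times\mathcal{U}\times\mathcal{Y}\to\mathbb{R}^{q_L}$ and $f_M:\hat{\mathcal{X}}\times\mathcal{U}\times\mathcal{Y}\to\mathbb{R}^{q_M}$ are continuous. The nonlinearities satisfy (Lip) $\|f_L(z,u,y)-f_L(x,u,y)\|\le\|F(z-x)\|$ for all $x,z\in\mathcal{X}$, $u\in\mathcal{U}$, $y\in\mathcal{Y}$, with some $F\in\mathbb{R}^{j\times n}$, $j\in\mathbb{N}$; (Mon) $(z-x)^\top\Theta\big(f_M(z,u,y)-f_M(x,u,y)\big)\ge\frac12\mu\|z-x\|^2$ for all $x,z\in\hat{\mathcal{X}}$,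 $u\in\mathcal{U}$, $y\in\mathcal{Y}$, with some $\Theta\in\mathbb{R}^{q_M\times q_M}$, $\mu\in\mathbb{R}$ ($\mu<0$ and singular $\Theta$ are allowed). Set $B:=[B_L,B_M]$ and $f(x,u,y):=\begin{pmatrix}f_L(x,u,y)\\ f_M(Jx,u,y)\end{pmatrix}$. **Observer candidate.** For $k\in\mathbb{N}_0$, $L_1\in\mathbb{R}^{l\times k}$, $L_2\in\mathbb{R}^{p\times k}$ the system $(\Omega)$ is $$\tfrac{d}{dt}Ez(t)=Az(t)+Bf(z(t),u(t),y(t))+L_1d(t),\qquad 0=Cz(t)-y(t)+h(u(t))+L_2d(t),$$ with state $x_o=\binom{z}{d}$ taking values in $\mathcal{X}_o=\mathcal{X}\times\mathbb{R}^k$, inputs $u,y$ and output $z$. **Solutions.** A solution of $(\Sigma)$ on an open interval $I$ is a triple $(x,u,y)\in C(I\to\mathcal{X}\times\mathcal{U}\times\mathcal{Y})$ with $x\in C^1$ satisfying the equations for all $t\in I$. A solution of $(\Omega)$ on $I$ is $\big(\binom{z}{d},\binom{u}{y},z\big)$ with $\binom{z}{d}\in C^1(I\to\mathcal{X}\times\mathbb{R}^k)$, $(u,y)\in C(I\to\mathcal{U}\times\mathcal{Y})$ satisfying the equations for all $t\in I$. The behaviors $\mathfrak{B}_\Sigma,\mathfrak{B}_\Omega$ are the sets of all solutions on all open intervals $I\subseteq\mathbb{R}$. **State estimator.** $(\Omega)$ is an acceptor for $(\Sigma)$ if for every $(x,u,y)\in\mathfrak{B}_\Sigma$ with domain $I$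 there is $\binom{z}{d}\in C^1(I\to\mathcal{X}\times\mathbb{R}^k)$ with $\big(\binom{z}{d},\binom{u}{y},z\big)\in\mathfrak{B}_\Omega$. $(\Omega)$ is a state estimator for $(\Sigma)$ if it is an acceptor for $(\Sigma)$ and for all $t_0\in\mathbb{R}$, whenever $(x,u,y)$ and $\big(\binom{z}{d},\binom{u}{y},z\big)$ (same $u,y$) are solutions of $(\Sigma)$ and $(\Omega)$ on $[t_0,\infty)$ (i.e. restrictions to $[t_0,\infty)$ of elements of $\mathfrak{B}_\Sigma$, $\mathfrak{B}_\Omega$), then $\lim_{t\to\infty}(z(t)-x(t))=0$. **Matrices.** $\mathcal{E}=\begin{bmatrix}E&0\\0&0\end{bmatrix}$, $\mathcal{A}=\begin{bmatrix}A&L_1\\C&L_2\end{bmatrix}$, $\hat A=\begin{bmatrix}A&0\\C&0\end{bmatrix}$ in $\mathbb{R}^{(l+p)\times(n+k)}$; $\mathcal{B}=\begin{bmatrix}B\\0\end{bmatrix}\in\mathbb{R}^{(l+p)\times(q_L+q_M)}$; $H=\begin{bmatrix}0_{n\times n}&0\\0&I_k\end{bmatrix}$; $\mathcal{F}=[F,0]\in\mathbb{R}^{j\times(n+k)}$; $\hat\Theta=\begin{bmatrix}0&J^\top\Theta\\0&0\end{bmatrix}\in\mathbb{R}^{(n+k)\times(q_L+q_M)}$; $\mathcal{J}=\begin{bmatrix}J^\top J&0\\0&0\end{bmatrix}\in\mathbb{R}^{(n+k)\times(n+k)}$; $\Lambda_{q_L}=\begin{bmatrix}I_{q_L}&0\\0&0\end{bmatrix}\in\mathbb{R}^{(q_L+q_M)\times(q_L+q_M)}$.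 **Wong limit.** For matrices $M,N$ of equal size $a\times b$: $\mathcal{V}^0_{[M,N]}:=\mathbb{R}^b$, $\mathcal{V}^{i+1}_{[M,N]}:=N^{-1}(M\mathcal{V}^i_{[M,N]})$ (preimage under $N$), $\mathcal{V}^*_{[M,N]}:=\bigcap_{i\in\mathbb{N}_0}\mathcal{V}^i_{[M,N]}$. Thus $\mathcal{V}^*_{[[\mathcal{E},0],[\mathcal{A},\mathcal{B}]]}\subseteq\mathbb{R}^{n+k+q_L+q_M}$, where $[\mathcal{E},0],[\mathcal{A},\mathcal{B}]\in\mathbb{R}^{(l+p)\times(n+k+q_L+q_M)}$, and $\overline{\mathcal{V}}^*_{[[\mathcal{E},0],[\mathcal{A},\mathcal{B}]]}:=[I_{n+k},0]\,\mathcal{V}^*_{[[\mathcal{E},0],[\mathcal{A},\mathcal{B}]]}$. **Definiteness on a subspace.** $M>_V0$ (resp. $M<_V0$) means $x^\top Mx>0$ (resp. $<0$) for all $x\in V\setminus\{0\}$. *)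

(* Defs.v *)
From HB Require Import structures.
From mathcomp Require Import all_boot all_order all_algebra.
From mathcomp Require Import all_classical all_reals all_analysis.

Set Implicit Arguments.
Unset Strict Implicit.
Unset Printing Implicit Defensive.

Import Order.TTheory GRing.Theory Num.Theory.
Import numFieldNormedType.Exports.

Local Open Scope classical_set_scope.
Local Open Scope ring_scope.

(* Vectors of R^n are columns 'cV[R]_n; the library norm on
   them is the sup norm, so the Euclidean norm is defined here. *)
Definition enorm (R : realType) (n : nat) (v : 'cV[R]_n) : R :=
  Num.sqrt (\sum_(i < n) v i 0 ^+ 2).

Definition qform (R : realType) (n : nat) (M : 'M[R]_n) (x : 'cV[R]_n) : R :=
  (x^T *m M *m x) 0 0.

Definition posdef_on (R : realType) (n : nat)
    (V : set 'cV[R]_n) (M : 'M[R]_n) : Prop :=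
  forall x : 'cV[R]_n, V x -> x != 0 -> 0 < qform M x.

Definition negdef_on (R : realType) (n : nat)
    (V : set 'cV[R]_n) (M : 'M[R]_n) : Prop :=
  forall x : 'cV[R]_n, V x -> x != 0 -> qform M x < 0.

Definition im (R : realType) (a b : nat) (M : 'M[R]_(a, b)) : set 'cV[R]_a :=
  range (fun v : 'cV[R]_b => M *m v).

Fixpoint wong (R : realType) (a b : nat) (M N : 'M[R]_(a, b)) (i : nat)
    : set 'cV[R]_b :=
  if i is i'.+1 then
    (fun v : 'cV[R]_b => N *m v) @^-1`
      ((fun v : 'cV[R]_b => M *m v) @` wong M N i')
  else setT.

Definition wong_limit (R : realType) (a b : nat) (M N : 'M[R]_(a, b))
    : set 'cV[R]_b :=
  \bigcap_(i in [set: nat]) wong M N i.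

(* The functions are total in Rocq, but only their values on the indicated
   domains are ever constrained or used. *)
Record dae_system (R : realType) (l n m p qL qM : nat) := DaeSystem {
  sysE : 'M[R]_(l, n);
  sysA : 'M[R]_(l, n);
  sysBL : 'M[R]_(l, qL);
  sysBM : 'M[R]_(l, qM);
  sysJ : 'M[R]_(qM, n);
  sysC : 'M[R]_(p, n);
  domX : set 'cV[R]_n;
  domU : set 'cV[R]_m;
  domY : set 'cV[R]_p;
  hfun : 'cV[R]_m -> 'cV[R]_p;
  fL : 'cV[R]_n -> 'cV[R]_m -> 'cV[R]_p -> 'cV[R]_qL;
  fM : 'cV[R]_qM -> 'cV[R]_m -> 'cV[R]_p -> 'cV[R]_qM;
  rank_sysJ : \rank sysJ = qM;
  open_domX : open domX;
  open_domU : open domU;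
  open_domY : open domY;
  continuous_hfun : {within domU, continuous hfun};
  continuous_fL : {within domX `*` domU `*` domY,
    continuous (fun w : 'cV[R]_n * 'cV[R]_m * 'cV[R]_p => fL w.1.1 w.1.2 w.2)};
  continuous_fM : {within ((fun x => sysJ *m x) @` domX) `*` domU `*` domY,
    continuous (fun w : 'cV[R]_qM * 'cV[R]_m * 'cV[R]_p => fM w.1.1 w.1.2 w.2)}
}.

Section System.
Variables (R : realType) (l n m p qL qM : nat).
Variable S : dae_system R l n m p qL qM.

Definition domXhat : set 'cV[R]_qM := (fun x => sysJ S *m x) @` domX S.

Definition lipschitz_condition (j : nat) (F : 'M[R]_(j, n)) : Prop :=
  forall (x z : 'cV[R]_n) (u : 'cV[R]_m) (y : 'cV[R]_p),
    domX S x -> domX S z -> domU S u -> domY S y ->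
    enorm (fL S z u y - fL S x u y) <= enorm (F *m (z - x)).

Definition monotonicity_condition (Theta : 'M[R]_qM) (mu : R) : Prop :=
  forall (x z : 'cV[R]_qM) (u : 'cV[R]_m) (y : 'cV[R]_p),
    domXhat x -> domXhat z -> domU S u -> domY S y ->
    2^-1 * mu * enorm (z - x) ^+ 2
      <= ((z - x)^T *m Theta *m (fM S z u y - fM S x u y)) 0 0.

Definition sysB : 'M[R]_(l, qL + qM) := row_mx (sysBL S) (sysBM S).

Definition fLM (x : 'cV[R]_n) (u : 'cV[R]_m) (y : 'cV[R]_p)
    : 'cV[R]_(qL + qM) :=
  col_mx (fL S x u y) (fM S (sysJ S *m x) u y).

Definition open_interval (I : set R) : Prop :=
  [/\ I !=set0, is_interval I & open I].

Definition C1_on (a : nat) (I : set R) (f : R -> 'cV[R]_a) : Prop :=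
  (forall t, I t -> derivable f t 1) /\ {within I, continuous (derive1 f)}.

Definition sys_solution (I : set R)
    (x : R -> 'cV[R]_n) (u : R -> 'cV[R]_m) (y : R -> 'cV[R]_p) : Prop :=
  [/\ open_interval I,
      C1_on I x /\ (forall t, I t -> domX S (x t)),
      {within I, continuous u} /\ (forall t, I t -> domU S (u t)),
      {within I, continuous y} /\ (forall t, I t -> domY S (y t))
    & forall t, I t ->
        derive1 (fun s => sysE S *m x s) t
          = sysA S *m x t + sysBL S *m fL S (x t) (u t) (y t)
            + sysBM S *m fM S (sysJ S *m x t) (u t) (y t)
        /\ y t = sysC S *m x t + hfun S (u t)].

(* The triple ((z, d), (u, y), z): the output z of the observer is the first
   component of its state and is not repeated. *)
Definition obs_solution (k : nat) (L1 : 'M[R]_(l, k)) (L2 : 'M[R]_(p, k))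
    (I : set R) (z : R -> 'cV[R]_n) (d : R -> 'cV[R]_k)
    (u : R -> 'cV[R]_m) (y : R -> 'cV[R]_p) : Prop :=
  [/\ open_interval I,
      [/\ C1_on I z, C1_on I d & forall t, I t -> domX S (z t)],
      {within I, continuous u} /\ (forall t, I t -> domU S (u t)),
      {within I, continuous y} /\ (forall t, I t -> domY S (y t))
    & forall t, I t ->
        derive1 (fun s => sysE S *m z s) t
          = sysA S *m z t + sysB *m fLM (z t) (u t) (y t) + L1 *m d t
        /\ 0 = sysC S *m z t - y t + hfun S (u t) + L2 *m d t].

(* Solutions on [t0, +oo[ are restrictions of elements of the behaviors; the
   two extensions to the left of t0 need not share their domain or inputs. *)
Definition sys_solution_ray (t0 : R)
    (x : R -> 'cV[R]_n) (u : R -> 'cV[R]_m) (y : R -> 'cV[R]_p) : Prop :=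
  exists I x' u' y',
    [/\ sys_solution I x' u' y', `[t0, +oo[ `<=` I
      & forall t, t0 <= t -> [/\ x' t = x t, u' t = u t & y' t = y t]].

Definition obs_solution_ray (k : nat) (L1 : 'M[R]_(l, k)) (L2 : 'M[R]_(p, k))
    (t0 : R) (z : R -> 'cV[R]_n) (d : R -> 'cV[R]_k)
    (u : R -> 'cV[R]_m) (y : R -> 'cV[R]_p) : Prop :=
  exists I z' d' u' y',
    [/\ obs_solution L1 L2 I z' d' u' y', `[t0, +oo[ `<=` I
      & forall t, t0 <= t ->
          [/\ z' t = z t, d' t = d t, u' t = u t & y' t = y t]].

Definition acceptor (k : nat) (L1 : 'M[R]_(l, k)) (L2 : 'M[R]_(p, k)) : Prop :=
  forall I x u y, sys_solution I x u y ->
    exists z d, obs_solution L1 L2 I z d u y.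

Definition state_estimator (k : nat) (L1 : 'M[R]_(l, k)) (L2 : 'M[R]_(p, k))
    : Prop :=
  acceptor L1 L2 /\
  forall t0 x u y z d,
    sys_solution_ray t0 x u y -> obs_solution_ray L1 L2 t0 z d u y ->
    z t - x t @[t --> +oo] --> (0 : 'cV[R]_n).

Definition calE (k : nat) : 'M[R]_(l + p, n + k) := block_mx (sysE S) 0 0 0.

Definition calA (k : nat) (L1 : 'M[R]_(l, k)) (L2 : 'M[R]_(p, k))
    : 'M[R]_(l + p, n + k) := block_mx (sysA S) L1 (sysC S) L2.

Definition Ahat (k : nat) : 'M[R]_(l + p, n + k) :=
  block_mx (sysA S) 0 (sysC S) 0.

Definition calB : 'M[R]_(l + p, qL + qM) := col_mx sysB 0.

Definition calJ (k : nat) : 'M[R]_(n + k) :=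
  block_mx ((sysJ S)^T *m sysJ S) 0 0 0.

Definition Thetahat (k : nat) (Theta : 'M[R]_qM)
    : 'M[R]_(n + k, qL + qM) := block_mx 0 ((sysJ S)^T *m Theta) 0 0.

Definition Hmx (k : nat) : 'M[R]_(n + k) := block_mx 0 0 0 1%:M.

Definition calF (k j : nat) (F : 'M[R]_(j, n)) : 'M[R]_(j, n + k) :=
  row_mx F 0.

Definition LambdaL : 'M[R]_(qL + qM) := block_mx 1%:M 0 0 0.

Definition Vstar (k : nat) (L1 : 'M[R]_(l, k)) (L2 : 'M[R]_(p, k))
    : set 'cV[R]_((n + k) + (qL + qM)) :=
  wong_limit (row_mx (calE k) 0) (row_mx (calA L1 L2) calB).

Definition Vbarstar (k : nat) (L1 : 'M[R]_(l, k)) (L2 : 'M[R]_(p, k))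
    : set 'cV[R]_(n + k) :=
  (fun v : 'cV[R]_((n + k) + (qL + qM)) =>
     (row_mx 1%:M 0 : 'M[R]_(n + k, (n + k) + (qL + qM))) *m v) @` Vstar L1 L2.

Definition calQ (k j : nat) (F : 'M[R]_(j, n)) (Theta : 'M[R]_qM) (mu delta : R)
    (P : 'M[R]_(l + p, n + k)) (K : 'M[R]_(n + k))
    : 'M[R]_((n + k) + (qL + qM)) :=
  block_mx
    ((Ahat k)^T *m P + P^T *m Ahat k + (Hmx k)^T *m K^T + K *m Hmx k
       + delta *: ((calF k F)^T *m calF k F) - mu *: calJ k)
    (P^T *m calB + Thetahat k Theta)
    (calB^T *m P + (Thetahat k Theta)^T)
    (- (delta *: LambdaL)).

End System.

Arguments Hmx {R} n k.

(* Main.v *)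
Require Import Defs.
From HB Require Import structures.
From mathcomp Require Import all_boot all_order all_algebra.
From mathcomp Require Import all_classical all_reals all_analysis.
From mathcomp Require Import ring lra.

Set Implicit Arguments.
Unset Strict Implicit.
Unset Printing Implicit Defensive.

Import Order.TTheory GRing.Theory Num.Theory.
Import numFieldNormedType.Exports.

Local Open Scope classical_set_scope.
Local Open Scope ring_scope.

(** Let (x, u, y) solve the system and ((z, d), (u, y), z) solve the observer.
    The error w = (z - x; d) and the increment phi = f(z) - f(x) of the
    nonlinearity satisfy the linear relation
    (calE w)' = calA w + calB phi.  Differentiating this algebraic
    constraint again and again confines v = (w; phi) to the Wong limit V*
    ([wong_trajectory]): a differentiable curve in a linear subspace has its
    derivative in that subspace.  So definiteness is only needed on V* and on
    its projection to the w-coordinates.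

    The Lyapunov function is W = w^T P^T calE w.  By symmetry of P^T calE its
    derivative is 2 w^T P^T (calA w + calB phi), and the block matrix calQ is
    designed so that this equals v^T calQ v minus a Lipschitz gap and a
    monotonicity gap, both nonnegative ([qform_calQ]).  Compactness of the unit
    sphere makes the definiteness assumptions uniform ([negdef_bound],
    [posdef_bound]):
      W' <= - b |v|^2 <= - b |w|^2 <= - (b / c) W   and   a |w|^2 <= W.
    Thus W decays exponentially ([exp_decay]), and w tends to 0
    ([error_cvg0]).

    The acceptor property holds because the observer can copy the system,
    z = x and d = 0.

    For the solvability criterion, an inclusion of column spaces yields X with
    P^T X = K H; since the first n columns of K H vanish, those of X may be
    replaced by 0, which is the shape of the gain matrix. *)

(** * Linear subspaces as kernels *)

Definition subspace_set (R : realType) (n : nat) (V : set 'cV[R]_n) : Prop :=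
  V 0 /\ forall (a : R) x y, V x -> V y -> V (a *: x + y).

(** Among the matrices whose row space lies in V, one of maximal rank has row
    space exactly V: otherwise adjoining a missing vector would raise the
    rank. *)
Lemma subspace_rowspace (R : realType) (n : nat) (V : set 'cV[R]_n) :
  subspace_set V -> exists U : 'M[R]_n, forall v, V v <-> (v^T <= U)%MS.
Proof.
move=> [V0 Vlin].
have VD x y : V x -> V y -> V (x + y).
  by move=> Vx Vy; have := Vlin 1 _ _ Vx Vy; rewrite scale1r.
pose inV (U : 'M[R]_n) := forall v : 'cV[R]_n, (v^T <= U)%MS -> V v.
pose Pr r := `[< exists2 U : 'M[R]_n, inV U & \rank U = r >].
have Pr0 : exists r, Pr r.
  exists 0%N; apply/asboolP; exists 0; last by rewrite mxrank0.
  by move=> v; rewrite submx0 => /eqP/(congr1 trmx); rewrite trmxK trmx0 => ->.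
have Prn r : Pr r -> (r <= n)%N.
  by move=> /asboolP [U _ <-]; exact: rank_leq_row.
case: (ex_maxnP Pr0 Prn) => r /asboolP [U inU rU] rmax.
exists U => v; split=> [Vv|/inU//].
have inUv : inV (<<U>> + <<v^T>>)%MS.
  move=> w /sub_addsmxP [[/= D1 D2] wE].
  have -> : w = (D1 *m <<U>>%MS)^T + (D2 *m <<v^T>>%MS)^T.
    by rewrite -[LHS]trmxK wE -linearD.
  apply: VD; first by apply: inU; rewrite trmxK (submx_trans (submxMl _ _)) ?genmxE.
  have : ((D2 *m <<v^T>>)%MS <= v^T)%MS by rewrite (submx_trans (submxMl _ _)) ?genmxE.
  move=> /sub_rVP [a ->]; rewrite linearZ/= trmxK.
  by rewrite -[_ *: _]addr0; exact: Vlin.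
have : (\rank (<<U>> + <<v^T>>)%MS <= \rank U)%N.
  by rewrite rU; apply: rmax; apply/asboolP; exists (<<U>> + <<v^T>>)%MS.
have UUv : (U <= <<U>> + <<v^T>>)%MS by rewrite (submx_trans _ (addsmxSl _ _)) ?genmxE.
move=> rle; have : (<<U>> + <<v^T>> <= U)%MS.
  by rewrite -(mxrank_leqif_sup UUv).2 eqn_leq mxrankS.
by apply: submx_trans; rewrite (submx_trans _ (addsmxSr _ _)) ?genmxE.
Qed.

(** A description by equations makes V closed and stable under
    differentiation of curves. *)
Lemma subspace_kernel (R : realType) (n : nat) (V : set 'cV[R]_n) :
  subspace_set V -> exists N : 'M[R]_n, forall v, V v <-> N *m v = 0.
Proof.
move=> /subspace_rowspace [U VU]; exists (cokermx U)^T => v.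
rewrite VU submxE; split=> [/eqP h|h].
  by apply: trmx_inj; rewrite trmx_mul trmxK h trmx0.
by apply/eqP/trmx_inj; rewrite trmx_mul trmxK h trmx0.
Qed.

(** * Wong sequences *)

Lemma subspace_image (R : realType) (a b : nat) (M : 'M[R]_(a, b)) V :
  subspace_set V -> subspace_set ((fun v : 'cV[R]_b => M *m v) @` V).
Proof.
move=> [V0 Vlin]; split; first by exists 0; rewrite ?mulmx0.
move=> c _ _ [x Vx <-] [y Vy <-]; exists (c *: x + y); first exact: Vlin.
by rewrite mulmxDr -scalemxAr.
Qed.

Lemma subspace_wong (R : realType) (a b : nat) (M N : 'M[R]_(a, b)) i :
  subspace_set (wong M N i).
Proof.
elim: i => [|i /(subspace_image M) [V0 Vlin]] //=.
split; first by rewrite /preimage /= mulmx0.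
move=> c x y; rewrite /preimage /= mulmxDr -scalemxAr; exact: Vlin.
Qed.

Lemma subspace_wong_limit (R : realType) (a b : nat) (M N : 'M[R]_(a, b)) :
  subspace_set (wong_limit M N).
Proof.
split=> [i _|c x y Vx Vy i _]; first by have [] := subspace_wong M N i.
by have [_] := subspace_wong M N i; apply; [exact: Vx|exact: Vy].
Qed.

(** * Derivatives of matrix-valued curves *)

Lemma is_derive_mxP (R : realType) (a b : nat) (M : R -> 'M[R]_(a, b))
    (t : R) (dM : 'M[R]_(a, b)) :
  is_derive t 1 M dM <-> forall i j, is_derive t 1 (fun s => M s i j) (dM i j).
Proof.
split=> [[dMt <-] i j|h].
  have /derivable_mxP/(_ i j) dij := dMt.
  by rewrite derive_mx// mxE; exact: derivableP.
have dMt : derivable M t 1 by apply/(derivable_mxP M t 1) => i j; have [] := h i j.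
split=> //; apply/matrixP => i j; rewrite derive_mx// mxE.
by have [] := h i j.
Qed.

Lemma is_derive_mulmx (R : realType) (a b c : nat) (M : R -> 'M[R]_(a, b))
    (N : R -> 'M[R]_(b, c)) (t : R) (dM : 'M[R]_(a, b))
    (dN : 'M[R]_(b, c)) :
  is_derive t 1 M dM -> is_derive t 1 N dN ->
  is_derive t 1 (fun s => M s *m N s) (dM *m N t + M t *m dN).
Proof.
move=> /is_derive_mxP hM /is_derive_mxP hN; apply/is_derive_mxP => i j.
have -> : (fun s => (M s *m N s) i j) =
    \sum_(h < b) ((fun s => M s i h) * (fun s => N s h j)).
  by apply/funext => s; rewrite mxE fct_sumE.
apply: is_derive_eq; rewrite !mxE -big_split; apply: eq_bigr => h _ /=.
by rewrite addrC mulrC; congr (_ + _); rewrite mulrC.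
Qed.

Lemma is_derive_mulmxl (R : realType) (a b c : nat) (A : 'M[R]_(a, b))
    (N : R -> 'M[R]_(b, c)) (t : R) (dN : 'M[R]_(b, c)) :
  is_derive t 1 N dN -> is_derive t 1 (fun s => A *m N s) (A *m dN).
Proof.
move=> hN; rewrite -[A *m dN]add0r -(mul0mx _ (N t)).
by apply: (@is_derive_mulmx _ _ _ _ (cst A)) => //; exact: is_derive_cst.
Qed.

Lemma is_derive_trmx (R : realType) (a b : nat) (M : R -> 'M[R]_(a, b))
    (t : R) (dM : 'M[R]_(a, b)) :
  is_derive t 1 M dM -> is_derive t 1 (fun s => (M s)^T) dM^T.
Proof.
move=> /is_derive_mxP h; apply/is_derive_mxP => i j; rewrite mxE.
by under eq_fun do rewrite mxE.
Qed.

Lemma is_derive_col_mx (R : realType) (a b c : nat) (M : R -> 'M[R]_(a, c))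
    (N : R -> 'M[R]_(b, c)) (t : R) (dM : 'M[R]_(a, c))
    (dN : 'M[R]_(b, c)) :
  is_derive t 1 M dM -> is_derive t 1 N dN ->
  is_derive t 1 (fun s => col_mx (M s) (N s)) (col_mx dM dN).
Proof.
move=> /is_derive_mxP hM /is_derive_mxP hN; apply/is_derive_mxP => i j.
case: (split_ordP i) => k ->.
  by rewrite col_mxEu; under eq_fun do rewrite col_mxEu.
by rewrite col_mxEd; under eq_fun do rewrite col_mxEd.
Qed.

(** If v stays in the i-th Wong space, M v stays in the image of that space
    under M, hence so does (M v)' = N v, which puts v in the next Wong space.
    The derivative is taken of M v as a whole because in the application v
    contains phi, which is merely continuous.  Times range over an open ray
    because the argument needs a two-sided neighbourhood. *)
Lemma wong_trajectory (R : realType) (a b : nat) (M N : 'M[R]_(a, b)) (t0 : R)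
    (v : R -> 'cV[R]_b) :
  (forall t, t0 < t -> is_derive t 1 (fun s => M *m v s) (N *m v t)) ->
  forall t, t0 < t -> wong_limit M N (v t).
Proof.
move=> dv t t0t i _; elim: i t t0t => [|i IH] t t0t //=.
have [Z VZ] := subspace_kernel (subspace_image M (subspace_wong M N i)).
apply/VZ; have dZ := is_derive_mulmxl Z (dv t t0t).
(* Z cuts out the image of the i-th Wong space, so Z M v vanishes near t. *)
have d0 : is_derive t 1 (fun s => Z *m (M *m v s)) 0.
  apply: near_eq_is_derive (is_derive_cst 0 t 1).
  near=> s; symmetry; apply/VZ; exists (v s) => //; apply: IH.
  by near: s; exact: lt_nbhsr.
by rewrite -(@derive_val _ _ _ _ _ _ _ dZ) (@derive_val _ _ _ _ _ _ _ d0).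
Unshelve. all: by end_near. Qed.

(** * Quadratic forms on subspaces *)

Definition sqn (R : realType) (n : nat) (x : 'cV[R]_n) : R :=
  \sum_(i < n) x i 0 ^+ 2.

Lemma sqn_ge0 (R : realType) (n : nat) (x : 'cV[R]_n) : 0 <= sqn x.
Proof. by apply: sumr_ge0 => i _; exact: sqr_ge0. Qed.

Lemma sqr_le_sqn (R : realType) (n : nat) (x : 'cV[R]_n) i : x i 0 ^+ 2 <= sqn x.
Proof.
rewrite /sqn (bigD1 i)//= lerDl; apply: sumr_ge0 => k _; exact: sqr_ge0.
Qed.

Lemma sqn_eq0 (R : realType) (n : nat) (x : 'cV[R]_n) : (sqn x == 0) = (x == 0).
Proof.
apply/idP/eqP => [/eqP x0|->].
  apply/colP => i; rewrite mxE; apply/eqP; rewrite -sqrf_eq0 eq_le sqr_ge0 andbT.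
  by rewrite -x0 sqr_le_sqn.
by rewrite /sqn big1// => i _; rewrite mxE expr0n.
Qed.

Lemma sqn_qform1 (R : realType) (n : nat) (x : 'cV[R]_n) : sqn x = qform 1%:M x.
Proof.
rewrite /qform mulmx1 mxE; apply: eq_bigr => i _.
by rewrite mxE expr2.
Qed.

Lemma qformZ (R : realType) (n : nat) (M : 'M[R]_n) a (x : 'cV[R]_n) :
  qform M (a *: x) = a ^+ 2 * qform M x.
Proof.
by rewrite /qform -scalemxAr linearZ/= -!scalemxAl scalerA mxE.
Qed.

Lemma qform0r (R : realType) (n : nat) (M : 'M[R]_n) : qform M 0 = 0.
Proof. by rewrite /qform mulmx0 mxE. Qed.

Lemma sqn0 (R : realType) (n : nat) : sqn (0 : 'cV[R]_n) = 0.
Proof. by apply/eqP; rewrite sqn_eq0. Qed.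

Lemma sqn_col_mx (R : realType) (a b : nat) (x : 'cV[R]_a) (y : 'cV[R]_b) :
  sqn (col_mx x y) = sqn x + sqn y.
Proof.
rewrite /sqn big_split_ord/=; congr (_ + _); apply: eq_bigr => i _.
  by rewrite col_mxEu.
by rewrite col_mxEd.
Qed.

(** The transposition is there because [bounded_closed_compact] speaks of row
    vectors. *)
Lemma continuous_mulmx_trmx (R : realType) (a b : nat) (M : 'M[R]_(a, b)) i :
  continuous (fun v : 'rV[R]_b => (M *m v^T) i 0).
Proof.
have -> : (fun v : 'rV[R]_b => (M *m v^T) i 0) =
    fun v : 'rV[R]_b => \sum_k M i k * v 0 k.
  by apply/funext => v; rewrite mxE; apply: eq_bigr => k _; rewrite mxE.
apply: continuous_big; first exact: add_continuous.
move=> k _ v; apply: (@cvgM _ _ (nbhs v) _ (cst (M i k)) (fun w : 'rV[R]_b => w 0 k)).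
  exact: cvg_cst.
exact: coord_continuous.
Qed.

Lemma continuous_qform_trmx (R : realType) (n : nat) (M : 'M[R]_n) :
  continuous (fun v : 'rV[R]_n => qform M v^T).
Proof.
have -> : (fun v : 'rV[R]_n => qform M v^T) =
    fun v : 'rV[R]_n => \sum_j v 0 j * (M *m v^T) j 0.
  by apply/funext => v; rewrite /qform trmxK -mulmxA mxE.
apply: continuous_big; first exact: add_continuous.
move=> k _ v; apply: (@cvgM _ _ (nbhs v) _ (fun w : 'rV[R]_n => w 0 k)
  (fun w => (M *m w^T) k 0)); first exact: coord_continuous.
exact: continuous_mulmx_trmx.
Qed.

(** The maximum of the form over the compact unit sphere of V, spread to V by
    homogeneity.  Exhibiting the maximizer, and not only the bound, lets strict
    definiteness of the form pass to the constant. *)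
Lemma qform_max (R : realType) (n : nat) (V : set 'cV[R]_n) (M : 'M[R]_n) :
  subspace_set V -> forall x0, V x0 -> x0 != 0 ->
  exists c, [/\ V c, c != 0 & forall v, V v -> qform M v <= qform M c * sqn v].
Proof.
move=> Vs x0 Vx0 x0n0; have [N VN] := subspace_kernel Vs; have [V0 Vlin] := Vs.
have VZ a x : V x -> V (a *: x) by move=> Vx; rewrite -[_ *: _]addr0; exact: Vlin.
have unitV x : x != 0 -> V x -> V ((Num.sqrt (sqn x))^-1 *: x) /\
    sqn ((Num.sqrt (sqn x))^-1 *: x) = 1.
  move=> xn0 Vx; split; first exact: VZ.
  rewrite sqn_qform1 qformZ -sqn_qform1 exprVn sqr_sqrtr ?sqn_ge0//.
  by rewrite mulVf// sqn_eq0.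
pose A := [set v : 'rV[R]_n | V v^T /\ sqn v^T = 1].
have A0 : A !=set0.
  by exists ((Num.sqrt (sqn x0))^-1 *: x0)^T; rewrite /A /= trmxK; exact: unitV.
have cA : compact A.
  apply: bounded_closed_compact.
    exists 1; split=> // B B1 v [_ v1]; apply: le_trans (ltW B1).
    rewrite [leLHS]/Num.Def.normr/= mx_normrE bigmax_le// => -[i k] _ /=.
    rewrite -(@ler_pXn2r _ 2)// ?nnegrE// expr1n (ord1 i).
    rewrite real_normK ?num_real// -v1.
    by have := sqr_le_sqn v^T k; rewrite mxE.
  (* A is closed: it is cut out by continuous equations. *)
  have -> : A = (\bigcap_(i in [set: 'I_n])
      (fun v : 'rV[R]_n => (N *m v^T) i 0) @^-1` [set x | x = 0]) `&`
      (fun v : 'rV[R]_n => qform 1%:M v^T) @^-1` [set x | x = 1].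
    apply/seteqP; split=> v /=.
      move=> [/VN Nv v1]; split; last by rewrite /= -sqn_qform1.
      by move=> i _ /=; rewrite Nv mxE.
    move=> [Nv v1]; split; last by rewrite sqn_qform1.
    by apply/VN/colP => i; rewrite (Nv i I) mxE.
  apply: closedI.
    apply: closed_bigI => i _; apply: preimage_closed; last exact: closed_eq.
    by move=> v _; exact: continuous_mulmx_trmx.
  apply: preimage_closed; last exact: closed_eq.
  by move=> v _; exact: continuous_qform_trmx.
have [c] := EVT_max_rV A0 cA
  (continuous_subspaceT (@continuous_qform_trmx _ _ M)).
rewrite inE => -[Vc c1] cmax; exists c^T; split=> //.
  by rewrite -sqn_eq0 c1 oner_eq0.
move=> v Vv; have [->|vn0] := eqVneq v 0.
  by rewrite qform0r sqn0 mulr0.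
have [Vu u1] := unitV _ vn0 Vv.
have := cmax ((Num.sqrt (sqn v))^-1 *: v)^T.
rewrite inE /A /= trmxK qformZ exprVn sqr_sqrtr ?sqn_ge0// => /(_ (conj Vu u1)).
by rewrite ler_pdivrMl ?lt_neqAle ?sqn_ge0 ?andbT ?(eq_sym 0) ?sqn_eq0// mulrC.
Qed.

Lemma negdef_bound (R : realType) (n : nat) (V : set 'cV[R]_n) (M : 'M[R]_n) :
  subspace_set V -> negdef_on V M ->
  exists2 b, 0 < b & forall v, V v -> qform M v <= - b * sqn v.
Proof.
move=> Vs Mneg; case: (pselect (exists2 x, V x & x != 0)) => [[x Vx xn0]|V0].
  have [c [Vc cn0 cmax]] := qform_max M Vs Vx xn0.
  exists (- qform M c); first by rewrite oppr_gt0 Mneg.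
  by move=> v Vv; rewrite opprK cmax.
exists 1 => // v Vv; have -> : v = 0.
  by apply/eqP/negP => /negP vn0; apply: V0; exists v.
by rewrite qform0r sqn0 mulr0.
Qed.

Lemma qformN (R : realType) (n : nat) (M : 'M[R]_n) (x : 'cV[R]_n) :
  qform (- M) x = - qform M x.
Proof. by rewrite /qform mulmxN mulNmx mxE. Qed.

Lemma posdef_bound (R : realType) (n : nat) (V : set 'cV[R]_n) (M : 'M[R]_n) :
  subspace_set V -> posdef_on V M ->
  exists2 a, 0 < a & forall v, V v -> a * sqn v <= qform M v.
Proof.
move=> Vs Mpos; have [|a a0 ha] := @negdef_bound _ _ _ (- M) Vs.
  by move=> v Vv vn0; rewrite qformN oppr_lt0 Mpos.
by exists a => // v Vv; rewrite -lerN2 -qformN -mulNr ha.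
Qed.

(** The maximum of the form on the sphere may be nonpositive, so it is replaced
    by a positive constant, by which the decay rate can be divided. *)
Lemma qform_bound (R : realType) (n : nat) (M : 'M[R]_n) :
  exists2 c, 0 < c & forall v, qform M v <= c * sqn v.
Proof.
case: (pselect (exists x : 'cV[R]_n, x != 0)) => [[x xn0]|V0].
  have [c [_ _ cmax]] := @qform_max _ _ setT M (conj I (fun _ _ _ _ _ => I)) x I xn0.
  exists (Num.max 1 (qform M c)); first by rewrite lt_max ltr01.
  move=> v; apply: le_trans (cmax v I) _.
  by rewrite ler_wpM2r ?sqn_ge0// le_max lexx orbT.
exists 1 => // v; have -> : v = 0.
  by apply/eqP/negP => /negP vn0; apply: V0; exists v.
by rewrite qform0r sqn0 mulr0.
Qed.

(** * Convergence *)

(** The topology on column vectors is that of the sup norm, which is bounded by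
    the Euclidean one. *)
Lemma sqn_cvg0 (R : realType) (n : nat) (f : R -> 'cV[R]_n) :
  sqn (f t) @[t --> +oo] --> 0 -> f t @[t --> +oo] --> (0 : 'cV[R]_n).
Proof.
move=> h; apply/cvgrPdist_le => e e0.
move/cvgrPdist_le : h => /(_ (e ^+ 2)) /[!exprn_gt0]// /(_ isT) h.
near=> t; have ht : sqn (f t) <= e ^+ 2.
  by apply: le_trans (ler_norm _) _; rewrite -normrN -sub0r; near: t.
rewrite sub0r normrN [leLHS]/Num.Def.normr/= mx_normrE.
rewrite bigmax_le ?(ltW e0)// => -[i k] _ /=; rewrite (ord1 k).
rewrite -(@ler_pXn2r _ 2)// ?nnegrE ?(ltW e0)// real_normK ?num_real//.
exact: le_trans (sqr_le_sqn _ _) ht.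
Unshelve. all: by end_near. Qed.

(** By the differential inequality, V(t) exp(c t) is nonincreasing. *)
Lemma exp_decay (R : realType) (V : R -> R) (t0 c : R) : 0 < c ->
  (forall t, t0 <= t -> 0 <= V t) ->
  (forall t, t0 <= t -> exists2 dV, is_derive t 1 V dV & dV <= - c * V t) ->
  V t @[t --> +oo] --> 0.
Proof.
move=> c0 V0 dV.
pose g := V * (fun s => expR (c * s)).
have dg t : t0 <= t -> exists2 dg, is_derive t 1 g dg & dg <= 0.
  move=> /dV [v dVt vle].
  have dE : is_derive t 1 (fun s => expR (c * s)) (expR (c * t) * c).
    apply: (@is_derive1_comp _ expR ( *%R c)).
    by apply: is_derive_eq; rewrite /GRing.scale /= mulr1.
  exists (V t *: (expR (c * t) * c) + expR (c * t) *: v).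
    exact: is_deriveM.
  rewrite /GRing.scale /= mulrCA -mulrDr pmulr_rle0 ?expR_gt0//.
  by rewrite mulrC -[X in X + _]opprK -mulNr addrC subr_le0.
have gle t : t0 <= t -> g t <= g t0.
  move=> t0t; apply: (@ler0_derive1_nincry _ g t0) => //.
  - by move=> s; rewrite in_itv/= andbT => /ltW /dg [? [? _]].
  - move=> s; rewrite in_itv/= andbT => /ltW /dg [d ds dle].
    by rewrite derive1E derive_val.
  - apply: derivable_within_continuous => s; rewrite in_itv/= andbT.
    by move=> /dg [? [? _]].
have VleE t : t0 <= t -> V t <= g t0 * expR (- (c * t)).
  move=> t0t; have := gle _ t0t; rewrite -(ler_pM2r (expR_gt0 (- (c * t)))).
  by rewrite /g /= -mulrA expRxMexpNx_1 mulr1.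
have lim0 : g t0 * expR (- (c * t)) @[t --> +oo] --> 0.
  rewrite -[X in _ --> X](mulr0 (g t0)); apply: cvgM; first exact: cvg_cst.
  apply: (@cvg_comp _ _ _ ( *%R c) (fun x => expR (- x)) _ +oo); last exact: cvgr_expR.
  by apply: gt0_cvgMry => //; exact: cvg_id.
apply: (@squeeze_cvgr _ _ _ _ (cst 0) (fun t => g t0 * expR (- (c * t)))) => //.
- near=> t; have t0t : t0 <= t by near: t; apply: nbhs_pinfty_ge; exact: num_real.
  by rewrite V0//= VleE.
- exact: cvg_cst.
Unshelve. all: by end_near. Qed.

(** * The dissipation identity *)

Lemma qform_trmx (R : realType) (n : nat) (M : 'M[R]_n) (x : 'cV[R]_n) :
  qform M^T x = qform M x.
Proof.
transitivity ((x^T *m M *m x)^T 0 0); last by rewrite mxE.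
by rewrite /qform !trmx_mul trmxK mulmxA.
Qed.

Lemma qformD (R : realType) (n : nat) (M N : 'M[R]_n) (x : 'cV[R]_n) :
  qform (M + N) x = qform M x + qform N x.
Proof. by rewrite /qform mulmxDr mulmxDl mxE. Qed.

Lemma qformZl (R : realType) (n : nat) a (M : 'M[R]_n) (x : 'cV[R]_n) :
  qform (a *: M) x = a * qform M x.
Proof. by rewrite /qform -scalemxAr -scalemxAl mxE. Qed.

Lemma qform_gram (R : realType) (a n : nat) (M : 'M[R]_(a, n)) (x : 'cV[R]_n) :
  qform (M^T *m M) x = sqn (M *m x).
Proof. by rewrite sqn_qform1 /qform trmx_mul mulmx1 !mulmxA. Qed.

Lemma qform_block_sym (R : realType) (a b : nat) (M : 'M[R]_a) (N : 'M[R]_(a, b))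
    (D : 'M[R]_b) (x : 'cV[R]_a) (y : 'cV[R]_b) :
  qform (block_mx M N N^T D) (col_mx x y)
    = qform M x + 2 * (x^T *m N *m y) 0 0 + qform D y.
Proof.
have sym : (y^T *m N^T *m x) 0 0 = (x^T *m N *m y) 0 0.
  transitivity ((x^T *m N *m y)^T 0 0); last by rewrite mxE.
  by rewrite !trmx_mul trmxK mulmxA.
rewrite /qform tr_col_mx mul_row_block mul_row_col !mulmxDl.
by move: sym; rewrite !mxE => ->; ring.
Qed.

Lemma sqn_enorm (R : realType) (n : nat) (x : 'cV[R]_n) : enorm x ^+ 2 = sqn x.
Proof. by rewrite sqr_sqrtr ?sqn_ge0. Qed.

(** The design identity behind calQ.  The gain relation turns P^T Ahat + K H
    into P^T calA, so the unweighted part of calQ is the derivative of the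
    Lyapunov function; the terms in delta and in mu, Theta enter as the gaps of
    the Lipschitz and monotonicity inequalities, so that calQ < 0 survives
    dropping them. *)
Lemma qform_calQ (R : realType) (l n m p qL qM : nat)
    (S : dae_system R l n m p qL qM) (j : nat) (F : 'M[R]_(j, n))
    (Theta : 'M[R]_qM) (mu delta : R) (k : nat)
    (P : 'M[R]_(l + p, n + k)) (K : 'M[R]_(n + k))
    (L1 : 'M[R]_(l, k)) (L2 : 'M[R]_(p, k))
    (e : 'cV[R]_n) (d : 'cV[R]_k) (phiL : 'cV[R]_qL) (phiM : 'cV[R]_qM) :
  P^T *m block_mx 0 L1 0 L2 = K *m Hmx n k ->
  let w := col_mx e d in let phi := col_mx phiL phiM in
  qform (calQ S F Theta mu delta P K) (col_mx w phi)
    = 2 * (w^T *m P^T *m (calA S L1 L2 *m w + calB S *m phi)) 0 0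
      + (2 * ((sysJ S *m e)^T *m Theta *m phiM) 0 0 - mu * sqn (sysJ S *m e))
      + delta * (sqn (F *m e) - sqn phiL).
Proof.
move=> hK w phi.
have calAE : P^T *m calA S L1 L2 = P^T *m Ahat S k + K *m Hmx n k.
  by rewrite -hK -mulmxDr add_block_mx !add0r !addr0.
rewrite /calQ; have -> : (calB S)^T *m P + (Thetahat S k Theta)^T =
    (P^T *m calB S + Thetahat S k Theta)^T.
  by rewrite linearD/= trmx_mul trmxK.
rewrite qform_block_sym -scaleNr.
have -> : (Ahat S k)^T *m P + P^T *m Ahat S k + (Hmx n k)^T *m K^T + K *m Hmx n k
    = (P^T *m calA S L1 L2)^T + P^T *m calA S L1 L2.
  rewrite calAE linearD/= !trmx_mul trmxK -!addrA; congr (_ + _).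
  by rewrite addrCA.
rewrite -scaleNr !qformD !qformZl qform_trmx qform_gram.
have -> : calF k F *m w = F *m e by rewrite mul_row_col mul0mx addr0.
have -> : qform (calJ S k) w = sqn (sysJ S *m e).
  rewrite -qform_gram /qform tr_col_mx mul_row_block mul_row_col.
  by rewrite !mulmx0 !addr0 mul0mx addr0.
have -> : qform (LambdaL R qL qM) phi = sqn phiL.
  rewrite sqn_qform1 /qform tr_col_mx mul_row_block mul_row_col.
  by rewrite !mulmx0 !addr0 mul0mx addr0.
have -> : w^T *m (P^T *m calB S + Thetahat S k Theta) *m phi =
    w^T *m P^T *m (calB S *m phi) + (sysJ S *m e)^T *m Theta *m phiM.
  rewrite mulmxDr mulmxDl !mulmxA; congr (_ + _).
  rewrite tr_col_mx mul_row_block mul_row_col trmx_mul.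
  by rewrite !mulmx0 !addr0 mul0mx add0r !mulmxA.
have DE (X Y : 'M[R]_1) : (X + Y) 0 0 = X 0 0 + Y 0 0 by rewrite mxE.
rewrite [_ *m (_ + _)]mulmxDr !DE /qform !mulmxA.
ring.
Qed.

(** * Convergence of the observer error *)

(** The Lyapunov argument, for any curves that satisfy the linear error
    relation together with the Lipschitz and monotonicity inequalities
    pointwise. *)
Lemma error_cvg0 (R : realType) (l n m p qL qM : nat)
    (S : dae_system R l n m p qL qM) (j : nat) (F : 'M[R]_(j, n))
    (Theta : 'M[R]_qM) (mu delta : R) (k : nat)
    (P : 'M[R]_(l + p, n + k)) (K : 'M[R]_(n + k))
    (L1 : 'M[R]_(l, k)) (L2 : 'M[R]_(p, k)) (t0 : R)
    (e : R -> 'cV[R]_n) (d : R -> 'cV[R]_k)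
    (phiL : R -> 'cV[R]_qL) (phiM : R -> 'cV[R]_qM) :
  0 <= delta ->
  P^T *m block_mx 0 L1 0 L2 = K *m Hmx n k ->
  negdef_on (Vstar S L1 L2) (calQ S F Theta mu delta P K) ->
  P^T *m calE S k = (calE S k)^T *m P ->
  posdef_on (Vbarstar S L1 L2) (P^T *m calE S k) ->
  (forall t, t0 < t -> exists w' : 'cV[R]_(n + k),
     is_derive t 1 (fun s => col_mx (e s) (d s)) w' /\
     calE S k *m w' = calA S L1 L2 *m col_mx (e t) (d t)
                        + calB S *m col_mx (phiL t) (phiM t)) ->
  (forall t, t0 < t -> sqn (phiL t) <= sqn (F *m e t)) ->
  (forall t, t0 < t -> mu * sqn (sysJ S *m e t)
     <= 2 * ((sysJ S *m e t)^T *m Theta *m phiM t) 0 0) ->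
  e t @[t --> +oo] --> (0 : 'cV[R]_n).
Proof.
move=> delta0 hK Qneg Esym Epos dyn lipL monM.
pose w t := col_mx (e t) (d t); pose phi t := col_mx (phiL t) (phiM t).
pose v t := col_mx (w t) (phi t).
have Vv t : t0 < t -> Vstar S L1 L2 (v t).
  apply: wong_trajectory => {}t t0t; have [w' [dw wE]] := dyn t t0t.
  rewrite mul_row_col -wE.
  have -> : (fun s => row_mx (calE S k) 0 *m v s) = (fun s => calE S k *m w s).
    by apply/funext => s; rewrite mul_row_col mul0mx addr0.
  exact: is_derive_mulmxl.
have Vs : subspace_set (Vstar S L1 L2) := subspace_wong_limit _ _.
have Vw t : t0 < t -> Vbarstar S L1 L2 (w t).
  move=> t0t; exists (v t); first exact: Vv.
  by rewrite mul_row_col mul1mx mul0mx addr0.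
have [b b0 Qle] := negdef_bound Vs Qneg.
have [a a0 leE] := posdef_bound (subspace_image (row_mx 1%:M 0) Vs) Epos.
have [c c0 Ele] := qform_bound (P^T *m calE S k).
pose W t := qform (P^T *m calE S k) (w t).
(* The error relation holds on an open ray only, so decay starts at t0 + 1. *)
have W0 : W t @[t --> +oo] --> 0.
  apply: (@exp_decay _ _ (t0 + 1) (b / c)); first exact: divr_gt0.
    move=> t t0t; apply: le_trans (leE _ (Vw t _)); last first.
      by rewrite (lt_le_trans _ t0t)// ltrDl.
    by rewrite mulr_ge0 ?sqn_ge0// ltW.
  move=> t t1t; have t0t : t0 < t by rewrite (lt_le_trans _ t1t)// ltrDl.
  have [w' [dw wE]] := dyn t t0t.
  pose s := (w t)^T *m P^T *m (calE S k *m w').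
  exists (2 * s 0 0).
    have /is_derive_mxP/(_ 0 0) dW : is_derive t 1
        (fun s => (w s)^T *m (P^T *m calE S k) *m w s)
        (w'^T *m (P^T *m calE S k) *m w t + (w t)^T *m (P^T *m calE S k) *m w').
      have /= dL := is_derive_mulmx (is_derive_trmx dw)
        (is_derive_cst (P^T *m calE S k) t 1).
      have := is_derive_mulmx dL dw.
      by rewrite mulmx0 addr0.
    apply: is_derive_eq; rewrite mxE mulr_natl mulr2n; congr (_ + _); last first.
      by rewrite /s !mulmxA.
    transitivity (s^T 0 0); last by rewrite mxE.
    by rewrite /s !trmx_mul !trmxK Esym !mulmxA.
  have QE := qform_calQ S F Theta mu delta (e t) (d t) (phiL t) (phiM t) hK.
  have := Qle _ (Vv t t0t); rewrite QE -wE -/s.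
  have hmon : 0 <= 2 * ((sysJ S *m e t)^T *m Theta *m phiM t) 0 0
      - mu * sqn (sysJ S *m e t) by rewrite subr_ge0 monM.
  have hlip : 0 <= delta * (sqn (F *m e t) - sqn (phiL t)).
    by rewrite mulr_ge0// subr_ge0 lipL.
  have hW : b / c * W t <= b * sqn (v t).
    rewrite mulrAC -mulrA ler_pM2l// ler_pdivrMr// [_ * c]mulrC.
    apply: le_trans (Ele _) _; rewrite ler_pM2l// (sqn_col_mx (w t)) lerDl.
    exact: sqn_ge0.
  by rewrite -/(v t) !mulNr => ?; lra.
apply: sqn_cvg0.
apply: (@squeeze_cvgr _ _ _ _ (cst 0) (fun t => a^-1 * W t)).
- near=> t; have t0t : t0 < t by near: t; apply: nbhs_pinfty_gt; exact: num_real.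
  rewrite sqn_ge0/= ler_pdivlMl//; apply: le_trans (leE _ (Vw t t0t)).
  by rewrite ler_pM2l// sqn_col_mx lerDl sqn_ge0.
- exact: cvg_cst.
- rewrite -[X in _ --> X](mulr0 a^-1); apply: cvgM W0; exact: cvg_cst.
Unshelve. all: by end_near. Qed.

(** With d = 0 the gains drop out, and the observer equations at z = x are
    those of the system. *)
Lemma acceptor_of_copy (R : realType) (l n m p qL qM : nat)
    (S : dae_system R l n m p qL qM) (k : nat)
    (L1 : 'M[R]_(l, k)) (L2 : 'M[R]_(p, k)) : acceptor S L1 L2.
Proof.
move=> I x u y [oI [C1x Xx] Cu Cy eqs]; exists x, (cst 0); split=> //.
  split=> //; split=> [t _|]; first exact: derivable_cst.
  rewrite (_ : derive1 _ = cst 0); first by apply: continuous_subspaceT => t; exact: cvg_cst.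
  by apply/funext => t; rewrite derive1E derive_cst.
move=> t It; have [-> ->] := eqs t It; rewrite !mulmx0 !addr0 mul_row_col addrA.
by split=> //; rewrite opprD addrA subrK subrr.
Qed.

(** On the common ray the two extended solutions share u and y, so their
    difference obeys the error relation there; the output terms h(u) cancel in
    the second block row. *)
Lemma estimator_cvg (R : realType) (l n m p qL qM : nat)
    (S : dae_system R l n m p qL qM)
    (j : nat) (F : 'M[R]_(j, n)) (Theta : 'M[R]_qM) (mu : R)
    (k : nat) (delta : R)
    (P : 'M[R]_(l + p, n + k)) (K : 'M[R]_(n + k))
    (L1 : 'M[R]_(l, k)) (L2 : 'M[R]_(p, k)) t0 x u y z d :
  lipschitz_condition S F ->
  monotonicity_condition S Theta mu ->
  0 < delta ->
  P^T *m block_mx 0 L1 0 L2 = K *m Hmx n k ->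
  negdef_on (Vstar S L1 L2) (calQ S F Theta mu delta P K) ->
  P^T *m calE S k = (calE S k)^T *m P ->
  posdef_on (Vbarstar S L1 L2) (P^T *m calE S k) ->
  sys_solution_ray S t0 x u y -> obs_solution_ray S L1 L2 t0 z d u y ->
  z t - x t @[t --> +oo] --> (0 : 'cV[R]_n).
Proof.
move=> hLip hMon hdelta hK Qneg Esym Epos.
move=> [I [x' [u' [y' [[_ [[dx _] Xx] [_ Uu] [_ Yy] sysx] subI xx']]]]].
move=> [I2 [z' [d' [u2 [y2 [[_ [[dz _] [dd _] Xz] _ _ obsz] subI2 zz']]]]]].
have inI t : t0 < t -> I t /\ I2 t.
  by move=> t0t; split; [apply: subI|apply: subI2];
    rewrite /= in_itv/= andbT ltW.
have uy t : t0 < t -> u2 t = u' t /\ y2 t = y' t.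
  by move=> /ltW t0t; have [_ _ -> ->] := zz' t t0t; have [_ -> ->] := xx' t t0t.
have zx : z' t - x' t @[t --> +oo] --> (0 : 'cV[R]_n).
  apply: (error_cvg0 (t0 := t0) (d := d')
    (phiL := fun t => fL S (z' t) (u' t) (y' t) - fL S (x' t) (u' t) (y' t))
    (phiM := fun t => fM S (sysJ S *m z' t) (u' t) (y' t)
                      - fM S (sysJ S *m x' t) (u' t) (y' t))
    (ltW hdelta) hK Qneg Esym Epos).
  - move=> t t0t; have [It I2t] := inI t t0t; have [uE yE] := uy t t0t.
    have [sx yx] := sysx t It; have [oz yz] := obsz t I2t.
    have Dx := derivableP (dx t It); have Dz := derivableP (dz t I2t).
    have Dd := derivableP (dd t I2t).
    eexists; split; first exact: (is_derive_col_mx (is_deriveB Dz Dx) Dd).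
    move: sx oz; rewrite !derive1E.
    rewrite (@derive_val _ _ _ _ _ _ _ (is_derive_mulmxl (sysE S) Dx)).
    rewrite (@derive_val _ _ _ _ _ _ _ (is_derive_mulmxl (sysE S) Dz)) => sx oz.
    rewrite mul_block_col mulmxBr sx oz !mul0mx addr0 addr0.
    rewrite mul_block_col mul_col_mx mul0mx add_col_mx addr0.
    rewrite uE yE; congr col_mx.
      rewrite /sysB /fLM !mul_row_col !mulmxBr.
      by apply/colP => i; rewrite !mxE; ring.
    rewrite [LHS]yz uE yE yx mulmxBr; congr (_ + _).
    by rewrite opprD addrA subrK.
  - move=> t t0t; have [It I2t] := inI t t0t.
    rewrite -!sqn_enorm ler_pXn2r ?nnegrE ?sqrtr_ge0//.
    by apply: hLip; [exact: Xx|exact: Xz|exact: Uu|exact: Yy].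
  - move=> t t0t; have [It I2t] := inI t t0t.
    rewrite -sqn_enorm mulmxBr -ler_pdivrMl// mulrA.
    apply: hMon; [by exists (x' t); first exact: Xx|by exists (z' t); first exact: Xz|exact: Uu|exact: Yy].
apply: cvg_trans zx; apply: near_eq_cvg; near=> t.
have t0t : t0 <= t by near: t; apply: nbhs_pinfty_ge; exact: num_real.
by have [-> _ _] := xx' t t0t; have [-> _ _ _] := zz' t t0t.
Unshelve. all: by end_near. Qed.

(** * Solvability for the gains *)

(** Column-wise, the inclusion says that K H = P^T X for some X.  Right
    multiplication by H kills the first n columns, so only the last k columns
    of X matter. *)
Lemma gain_exists (R : realType) (a n k : nat) (P : 'M[R]_(a, n + k))
    (K : 'M[R]_(n + k)) :
  im (K *m Hmx n k) `<=` im P^T ->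
  exists L : 'M[R]_(a, k), P^T *m row_mx 0 L = K *m Hmx n k.
Proof.
move=> sub.
have sub2 : ((K *m Hmx n k)^T <= P)%MS.
  apply/row_subP => i; rewrite -tr_col.
  have [v _ vE] : im P^T (col i (K *m Hmx n k)).
    by apply: sub; exists (delta_mx i 0) => //; rewrite colE.
  by rewrite -vE trmx_mul trmxK submxMl.
have [X XE] := submxP sub2; exists (rsubmx X^T).
have KHE : K *m Hmx n k = P^T *m row_mx (lsubmx X^T) (rsubmx X^T).
  by rewrite hsubmxK -trmx_mul -XE trmxK.
have KH0 : lsubmx (K *m Hmx n k) = 0.
  by rewrite -[K]hsubmxK mul_row_block !mulmx0 !addr0 row_mxKl.
move: KH0; rewrite KHE !mul_mx_row row_mxKl => ->.
by rewrite mulmx0.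
Qed.

Theorem theorem4p1 (R : realType) (l n m p qL qM : nat)
    (S : dae_system R l n m p qL qM)
    (j : nat) (F : 'M[R]_(j, n)) (Theta : 'M[R]_qM) (mu : R)
    (hLip : lipschitz_condition S F)
    (hMon : monotonicity_condition S Theta mu)
    (hnlp : (n <= l + p)%N)
    (k : nat) (delta : R) (hdelta : 0 < delta)
    (P : 'M[R]_(l + p, n + k)) (K : 'M[R]_(n + k)) :
  (forall (L1 : 'M[R]_(l, k)) (L2 : 'M[R]_(p, k)),
     P^T *m block_mx 0 L1 0 L2 = K *m Hmx n k ->
     negdef_on (Vstar S L1 L2) (calQ S F Theta mu delta P K) ->
     P^T *m calE S k = (calE S k)^T *m P ->
     posdef_on (Vbarstar S L1 L2) (P^T *m calE S k) ->
     state_estimator S L1 L2)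
  /\
  ((exists (L1 : 'M[R]_(l, k)) (L2 : 'M[R]_(p, k)),
      P^T *m block_mx 0 L1 0 L2 = K *m Hmx n k)
   <-> im (K *m Hmx n k) `<=` im P^T).
Proof.
split=> [L1 L2 hK Qneg Esym Epos|].
  split; first exact: acceptor_of_copy.
  by move=> t0 x u y z d; exact: (estimator_cvg hLip hMon hdelta hK Qneg Esym Epos).
split=> [[L1 [L2 <-]] _ [v _ <-]|/gain_exists [L hL]].
  by exists (block_mx 0 L1 0 L2 *m v); rewrite ?mulmxA.
exists (usubmx L), (dsubmx L); rewrite -hL; congr (_ *m _).
by rewrite block_mxEh vsubmxK col_mx0.
Qed.
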